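(* Let $G$ be a finite group, $p$ a prime number, and $n\ge 0$ an integer. The poset $\mathcal{A}_p(G)$ is contractible in $n$ steps if and only if one of the following holds: (1) $n=0$ and $\mathcal{A}_p(G)=\{*\}$ (a single element); (2) $n\geq 1$ is even and $\bigcap_{A\in\mathcal{M}_{n-1}}A>1$ (i.e. this intersection is a non-trivial subgroup); (3) $n\geq 1$ is odd and the subgroup $\langle A: A\in\mathcal{M}_{n-1}\rangle$ of $G$ is abelian.
   Context: $\mathcal{A}_p(G)$ is the poset of non-trivial elementary abelian $p$-subgroups of $G$, ordered by inclusion. Contractibility in steps: a finite poset $X$ is contractible in $n$ steps ($n\ge 0$) if there exist $x_0\in X$ and order-preserving maps $\mathrm{Id}_X=f_0,f_1,\ldots,f_n=c_{x_0}:X\to X$, where $c_{x_0}$ is the constant map with value $x_0$, such that $f_i,f_{i+1}$ are comparable (pointwise) for every $0\le i<n$. Reduced lattices: a finite poset $X$ is a reduced lattice if it is the proper part $L-\{\hat 0,\hat 1\}$ of a lattice $L$; equivalently, every pair of elements with an upper bound in $X$ has a supremum in $X$; equivalently, every pair with a lower bound in $X$ has an infimum in $X$. $M(X)$ and $m(X)$ denote the sets of maximal and minimal elements of $X$. For a reduced lattice $X$ put $$\mathfrak{i}(X)=\Big\{\bigwedge_{x\in S}x : S\subseteq M(X),\ S\ne\emptyset\text{ and lower bounded in }X\Big\},\qquad \mathfrak{s}(X)=\Big\{\bigvee_{x\in S}x : S\subseteq m(X),\ S\neq\emptyset\text{ and upper bounded in }X\Big\},$$ with infima and suprema taken in $X$;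 these are subposets of $X$ which are again reduced lattices, so the operations can be iterated (at each stage, the extremal elements, bounds, infima and suprema are those of the poset to which the operation is applied). $X$ is atomic if every element is the supremum of the minimal elements below it. The poset $X=\mathcal{A}_p(G)$ is an atomic reduced lattice (the infimum of two elements with a lower bound is their intersection and the supremum of two elements with an upper bound is the subgroup they generate). For $n\ge 0$ let $X_n=\mathcal{A}_p(G)_n$ be the $(n+1)$-th term of the sequence $$X\supseteq \mathfrak{i}(X)\supseteq \mathfrak{s}\mathfrak{i}(X)\supseteq \mathfrak{i}\mathfrak{s}\mathfrak{i}(X)\supseteq\cdots$$ (so $X_0=X$, $X_1=\mathfrak{i}(X)$, $X_2=\mathfrak{s}(\mathfrak{i}(X))$, etc.). Set $\mathcal{M}_n=m(X_n)$ if $n$ is even and $\mathcal{M}_n=M(X_n)$ if $n$ is odd.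
   Formalization: The formal statement assumes that p divides |G|, i.e. that A_p(G) is non-empty; otherwise A_p(G) is empty and not contractible, while for odd n condition (3) holds because the subgroup generated by the empty family is trivial. *)

(* Defs.v *)
From HB Require Import structures.
From mathcomp Require Import all_boot all_order all_fingroup all_solvable.

Set Implicit Arguments.
Unset Strict Implicit.
Unset Printing Implicit Defensive.

Local Open Scope order_scope.

(* A finite poset is a set X : {set T} of elements of a finPOrderType T, with
   the order induced by T. All notions below are relative to X, so that the
   operations on subposets can be iterated inside the same ambient type. *)
Section FinitePosets.

Context {d : Order.disp_t} {T : finPOrderType d}.
Implicit Types (X S : {set T}) (x : T).

Definition maximals X : {set T} :=
  [set x in X | [forall y in X, (x <= y) ==> (y == x)]].

Definition minimals X : {set T} :=
  [set x in X | [forall y in X, (y <= x) ==> (y == x)]].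

Definition lower_bounds X S : {set T} :=
  [set x in X | [forall y in S, x <= y]].

Definition upper_bounds X S : {set T} :=
  [set x in X | [forall y in S, y <= x]].

Definition is_inf X S x : bool :=
  (x \in lower_bounds X S) && [forall z in lower_bounds X S, z <= x].

Definition is_sup X S x : bool :=
  (x \in upper_bounds X S) && [forall z in upper_bounds X S, x <= z].

(* In a reduced lattice X every nonempty S that is lower (resp. upper) bounded
   in X has an infimum (resp. a supremum) in X; conversely, having an infimum
   in X forces S to be lower bounded in X, so that boundedness needs no
   separate clause. *)
Definition inf_poset X : {set T} :=
  [set x in X | [exists S : {set T},
     [&& S \subset maximals X, S != set0 & is_inf X S x]]].

Definition sup_poset X : {set T} :=
  [set x in X | [exists S : {set T},
     [&& S \subset minimals X, S != set0 & is_sup X S x]]].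

(* X, i(X), s(i(X)), i(s(i(X))), and so on. *)
Fixpoint iter_poset X (n : nat) : {set T} :=
  if n is n'.+1 then
    if odd n' then sup_poset (iter_poset X n')
    else inf_poset (iter_poset X n')
  else X.

(* Order-preserving maps X -> X are represented by functions on T that are
   constrained only on X; the values of f k for k > n are irrelevant. *)
Definition contractible_in_steps X (n : nat) : Prop :=
  exists (x0 : T) (f : nat -> T -> T),
    [/\ x0 \in X,
        forall k, (k <= n)%N ->
          {in X, forall x, f k x \in X} /\
          {in X &, {homo f k : x y / x <= y}},
        {in X, forall x, f 0%N x = x},
        {in X, forall x, f n x = x0} &
        forall k, (k < n)%N ->
          {in X, forall x, f k x <= f k.+1 x} \/
          {in X, forall x, f k.+1 x <= f k x}].

End FinitePosets.

Section SubgroupOrder.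

Variable gT : finGroupType.

Definition subgroup_le (A B : {group gT}) : bool := A \subset B.

Lemma subgroup_le_refl : reflexive subgroup_le.
Proof. by move=> A; exact: subxx. Qed.

Lemma subgroup_le_anti : antisymmetric subgroup_le.
Proof. by move=> A B /andP[sAB sBA]; apply/val_inj/eqP; rewrite eqEsubset; apply/andP. Qed.

Lemma subgroup_le_trans : transitive subgroup_le.
Proof. by move=> B A C; exact: subset_trans. Qed.

End SubgroupOrder.

Fact subgroup_display : Order.disp_t. Proof. exact: Order.Disp tt tt. Qed.

HB.instance Definition _ (gT : finGroupType) :=
  Order.Le_isPOrder.Build subgroup_display {group gT}
    (@subgroup_le_refl gT) (@subgroup_le_anti gT) (@subgroup_le_trans gT).

Lemma subgroup_leE (gT : finGroupType) (A B : {group gT}) :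
  (A <= B) = (A \subset B).
Proof. by []. Qed.

Section Ap.

Context {gT : finGroupType}.

Definition Ap (p : nat) (G : {group gT}) : {set {group gT}} :=
  [set A in 'E_p(G) | A :!=: 1]%g.

Definition Ap_extremals (p : nat) (G : {group gT}) (n : nat) :
    {set {group gT}} :=
  if odd n then maximals (iter_poset (Ap p G) n)
  else minimals (iter_poset (Ap p G) n).

End Ap.

(* Main.v *)
Require Import Defs.
From mathcomp Require Import all_boot all_order all_fingroup all_solvable.

(** Let [X] be a reduced lattice. Sending [x] to the infimum of the maximal
    elements above it is a closure operator [hull X] on [X] with image
    [inf_poset X], again a reduced lattice, in which moreover every element is
    an infimum of maximal ones. A contraction whose first step goes up may as
    well begin with this operator: a monotone map [g] above the identity fixes
    the maximal elements, hence [hull X \o g] is the identity on the image, and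
    composing the remaining maps with [hull X] gives a contraction of
    [inf_poset X] with one step less, whose first step goes down
    ([fence_inf_poset]). This is the same situation for the reversed order, so
    every further argument is an induction that alternates between an order and
    its dual.

    Steps in the same direction merge, so the steps of a contraction can be
    made to alternate. That the first one goes up is no restriction when [X] is
    atomic: a monotone map below the identity fixes the minimal elements, hence
    everything ([atomic_fence]). Hence [X] is contractible in [n + 1] steps if
    and only if its [n]-th iterate is contractible in one step in the direction
    prescribed by parity, that is, has a greatest element ([n] even) or a least
    one ([n] odd) ([fence_iter]).

    By (co)atomicity of the iterate such an element is a bound in the iterate of
    its minimal or maximal elements. A bound in [X] is enough, because the
    closure operators carry it into the iterate and fix the elements to be
    bounded ([bounds_extremals]). In the poset of non-trivial elementary abelian
    [p]-subgroups of [G], a nonempty family is bounded above when it generates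
    an abelian group, and bounded below when its intersection is
    non-trivial. *)

Set Implicit Arguments.
Unset Strict Implicit.
Unset Printing Implicit Defensive.

Import Order.LTheory.

(** * Extremal elements and reduced lattices *)

Section Extrema.

Local Open Scope order_scope.

Context {d : Order.disp_t} {T : finPOrderType d}.
Implicit Types (X S : {set T}) (x y z m : T).

(** The same set, read in the reversed order. Minimal and maximal elements,
    infima and suprema are exchanged by conversion, so that a lemma about one
    notion gives the other when it is instantiated at [T^d]. *)
Definition dual_set X : {set T^d} := X.

Lemma lower_boundsP X S z :
  reflect (z \in X /\ {in S, forall s, z <= s}) (z \in lower_bounds X S).
Proof.
by rewrite inE; apply: (iffP andP) => -[zX /forall_inP zS]; split.
Qed.

Lemma is_infP X S x :
  reflect ([/\ x \in X, {in S, forall s, x <= s}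
             & forall z, z \in X -> {in S, forall s, z <= s} -> z <= x])
          (is_inf X S x).
Proof.
apply: (iffP andP) => [[/lower_boundsP[xX xS] /forall_inP xmax]|[xX xS xmax]].
  by split=> // z zX zS; apply: xmax; apply/lower_boundsP.
split; first exact/lower_boundsP.
by apply/forall_inP => z /lower_boundsP[]; apply: xmax.
Qed.

Lemma maximalsP X m :
  reflect (m \in X /\ {in X, forall y, m <= y -> y = m}) (m \in maximals X).
Proof.
rewrite inE; apply: (iffP andP) => -[mX mmax]; split=> //.
  by move=> y yX my; move/forall_inP/(_ y yX)/implyP/(_ my)/eqP: mmax.
by apply/forall_inP => y yX; apply/implyP => my; apply/eqP/mmax.
Qed.

Lemma maximals_sub X : maximals X \subset X.
Proof. by apply/subsetP => m /maximalsP[]. Qed.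

Lemma maximal_fixed X g m : m \in maximals X -> g m \in X -> m <= g m -> g m = m.
Proof. by move=> /maximalsP[_ mmax]; apply: mmax. Qed.

Lemma maximal_above X x :
  x \in X -> exists2 m, m \in maximals X & x <= m.
Proof.
move=> xX; pose P := [pred y | (y \in X) && (x <= y)].
have xP : P x by rewrite /= xX lexx.
(* An element y >= x with the largest number of elements below it. *)
case: (arg_maxnP (P := P) (fun y : T => #|[set z | z <= y]|) xP).
move=> m /andP[mX xm] mmax.
exists m => //; apply/maximalsP; split=> // y yX my.
have sub : [set z | z <= m] \subset [set z | z <= y].
  by apply/subsetP => z; rewrite !inE => zm; apply: le_trans zm my.
have /eqP/setP/(_ y) : [set z | z <= m] == [set z | z <= y].
  by rewrite eqEcard sub; apply: mmax; rewrite /P /= yX (le_trans xm my).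
by rewrite !inE lexx => ym; apply/le_anti; rewrite ym my.
Qed.

Definition reduced_lattice X : Prop :=
  forall S, S \subset X -> S != set0 -> lower_bounds X S != set0 ->
  exists x, is_inf X S x.

(** Comparing the minimal elements below two elements decides their order; for
    a single element this says that it is the supremum of those below it. *)
Definition atomic X : Prop :=
  {in X &, forall x y, (forall m, m \in minimals X -> m <= x -> m <= y) ->
    x <= y}.

End Extrema.

(** * Reversal of the order *)

Section Duality.

Local Open Scope order_scope.

Context {d : Order.disp_t} {T : finPOrderType d}.
Implicit Types (X S : {set T}) (x y z m : T).

(** The supremum of a set is the infimum of the set of its upper bounds. *)
Lemma reduced_lattice_dual X :
  reduced_lattice X -> reduced_lattice (dual_set X).
Proof.
move=> Xlat S SX /set0Pn[s sS] /set0Pn[u /lower_boundsP[uX uS]].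
pose U : {set T} := [set z in X | [forall t in S, (t : T) <= z]].
have UP z : reflect (z \in X /\ {in S, forall t : T, t <= z}) (z \in U).
  by rewrite inE; apply: (iffP andP) => -[zX /forall_inP zS]; split.
have UX : U \subset X by apply/subsetP => z /UP[].
have U0 : U != set0 by apply/set0Pn; exists u; apply/UP.
have sX : s \in X by apply: (subsetP SX).
have LU : lower_bounds X U != set0.
  apply/set0Pn; exists s; apply/lower_boundsP; split=> // z /UP[_]; exact.
have [x /is_infP[xX xU xmax]] := Xlat U UX U0 LU; exists x; apply/is_infP.
split=> //.
  move=> t tS; apply: xmax; first exact: (subsetP SX).
  by move=> z /UP[_]; apply.
by move=> z zX zS; apply: xU; apply/UP.
Qed.

(** Splitting off the innermost operation instead of the outermost one leaves an
    iteration that starts with suprema, that is, with infima in the reversed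
    order. *)
Lemma iter_poset_dual X n :
  iter_poset X n.+1 = iter_poset (dual_set (inf_poset X)) n.
Proof.
by elim: n => // n /= <-; case: (odd n).
Qed.

End Duality.

(** * The closure operator onto the infima of maximal elements *)

Section Hull.

Local Open Scope order_scope.

Context {d : Order.disp_t} {T : finPOrderType d}.
Variable X : {set T}.
Hypothesis Xlat : reduced_lattice X.
Implicit Types (x y z m : T).

(** The closure operator of [X] with image [inf_poset X]. *)
Definition hull x : T :=
  odflt x [pick z | is_inf X [set m in maximals X | x <= m] z].

Lemma hullP x : x \in X -> is_inf X [set m in maximals X | x <= m] (hull x).
Proof.
move=> xX; rewrite /hull; case: pickP => //= no_inf.
have [|||y] := Xlat (S := [set m in maximals X | x <= m]); last first.
- by move=> y_inf; have := no_inf y; rewrite /= y_inf.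
- apply/set0Pn; exists x; apply/lower_boundsP; split=> // s.
  by rewrite inE => /andP[].
- have [m mX xm] := maximal_above xX.
  by apply/set0Pn; exists m; rewrite inE mX.
- apply/subsetP => s; rewrite inE => /andP[sX _].
  exact: (subsetP (maximals_sub X)).
Qed.

Lemma hull_in x : x \in X -> hull x \in X.
Proof. by move=> /hullP/is_infP[]. Qed.

Lemma hull_le_maximal x m :
  x \in X -> m \in maximals X -> x <= m -> hull x <= m.
Proof.
by move=> /hullP/is_infP[_ hx _] mX xm; apply: hx; rewrite inE mX.
Qed.

Lemma hull_greatest x z : x \in X -> z \in X ->
  (forall m, m \in maximals X -> x <= m -> z <= m) -> z <= hull x.
Proof.
move=> /hullP/is_infP[_ _ hx] zX zm; apply: hx => // m.
by rewrite inE => /andP[mX xm]; apply: zm.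
Qed.

Lemma le_hull x : x \in X -> x <= hull x.
Proof. by move=> xX; apply: hull_greatest. Qed.

Lemma hull_homo : {in X &, {homo hull : x y / x <= y}}.
Proof.
move=> x y xX yX xy; apply: hull_greatest; rewrite ?hull_in // => m mX ym.
by apply: hull_le_maximal => //; apply: le_trans xy ym.
Qed.

Lemma inf_posetP y : reflect (y \in X /\ hull y = y) (y \in inf_poset X).
Proof.
rewrite inE; apply: (iffP andP) => -[yX].
  move=> /existsP[S /and3P[SX _ /is_infP[_ yS ymax]]]; split=> //.
  apply: le_anti; rewrite le_hull // andbT; apply: ymax; first exact: hull_in.
  move=> s sS; apply: hull_le_maximal (yS s sS) => //.
  exact: (subsetP SX).
move=> hy; split=> //; apply/existsP.
exists [set m in maximals X | y <= m]; apply/and3P; split.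
- by apply/subsetP => m; rewrite inE => /andP[].
- have [m mX ym] := maximal_above yX.
  by apply/set0Pn; exists m; rewrite inE mX.
- by rewrite -[y in is_inf _ _ y]hy hullP.
Qed.

Lemma inf_poset_sub : inf_poset X \subset X.
Proof. by apply/subsetP => y /inf_posetP[]. Qed.

Lemma hull_in_inf_poset x : x \in X -> hull x \in inf_poset X.
Proof.
move=> xX; have hX := hull_in xX; apply/inf_posetP; split=> //.
apply: le_anti; rewrite le_hull // andbT.
apply: hull_greatest; rewrite ?hull_in // => m mX xm.
by apply: hull_le_maximal => //; apply: hull_le_maximal.
Qed.

(** A lower bound of a set of closed elements stays one after closing it, so
    that infima in [X] of closed elements are closed. *)
Lemma reduced_lattice_inf_poset : reduced_lattice (inf_poset X).
Proof.
move=> S SI S0 /set0Pn[l /lower_boundsP[/inf_posetP[lX _] lS]].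
have SX := subset_trans SI inf_poset_sub.
have LS : lower_bounds X S != set0.
  by apply/set0Pn; exists l; apply/lower_boundsP.
have [x /is_infP[xX xS xmax]] := Xlat SX S0 LS.
exists x; apply/is_infP; split=> //.
  apply/inf_posetP; split=> //; apply: le_anti; rewrite le_hull // andbT.
  apply: xmax; first exact: hull_in.
  move=> s sS; have /inf_posetP[sX <-] := subsetP SI s sS.
  by apply: hull_homo => //; apply: xS.
by move=> z /inf_posetP[zX _]; apply: xmax.
Qed.

(** A maximal element of [X] is closed, hence remains maximal in the image,
    and a closed element is the infimum of the maximal ones above it. *)
Lemma coatomic_inf_poset : atomic (dual_set (inf_poset X)).
Proof.
move=> x y /inf_posetP[xX hx] /inf_posetP[yX hy] xy.
suff: (y : T) <= (x : T) by []; rewrite -hx; apply: hull_greatest => // m mX xm.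
apply: xy => //; apply/(@maximalsP _ T (inf_poset X)).
have [mX' mmax] := @maximalsP _ _ X m mX.
split=> [|z /inf_posetP[zX _]]; last exact: mmax.
apply/inf_posetP; split=> //.
exact: maximal_fixed mX (hull_in mX') (le_hull mX').
Qed.

End Hull.

(** * Alternating contractions *)

Section Fences.

Local Open Scope order_scope.

Definition endo d (T : finPOrderType d) (X : {set T}) (g : T -> T) : Prop :=
  {in X, forall x, g x \in X} /\ {in X &, {homo g : x y / x <= y}}.

(** A sequence [h <= g1 >= g2 <= ...] of [n] steps ending at a constant map;
    passing to the dual order at each step makes the signs alternate. *)
Fixpoint fence (n : nat) d (T : finPOrderType d) (X : {set T}) (h : T -> T)
    : Prop :=
  if n is n'.+1 then
    exists g : T -> T, [/\ endo X g, {in X, forall x, h x <= g x}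
                         & @fence n' _ T^d X g]
  else exists2 x0, x0 \in X & {in X, forall x, h x = x0}.

Lemma endo_dual d (T : finPOrderType d) (X : {set T}) g :
  endo X g -> endo (dual_set X) g.
Proof. by move=> [gX gh]; split=> // x y xX yX xy; apply: gh. Qed.

Lemma endo_id d (T : finPOrderType d) (X : {set T}) : endo X id.
Proof. by split. Qed.

(** Once [n] is a constructor, only the order relations of the two types are
    left to compare, and these are convertible. *)
Lemma fence_dualK n d (T : finPOrderType d) (X : {set T}) h :
  fence n (dual_set (dual_set X)) h <-> fence n X h.
Proof. by case: n; split. Qed.

(** Used both to restrict a fence to the image of a closure operator and to
    extend one from this image. *)
Lemma fence_transfer n d (T : finPOrderType d) (X Y : {set T}) (r s h : T -> T) :
  {in X, forall x, r x \in Y} -> {in X &, {homo r : x y / x <= y}} ->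
  {in Y, forall y, s y \in X} -> {in Y &, {homo s : x y / x <= y}} ->
  endo X h -> fence n X h -> fence n Y (r \o h \o s).
Proof.
elim: n d T X Y r s h => [|n IH] d T X Y r s h rX rh sY sh [hX hh] /=.
  case=> x0 x0X hx0; exists (r x0); first exact: rX.
  by move=> y yY /=; rewrite hx0 // sY.
move=> [g [[gX gh] hg gf]]; exists (r \o g \o s); split.
- split=> [y yY | y z yY zY yz] /=; first by rewrite rX ?gX ?sY.
  by apply: rh; rewrite ?gX ?sY //; apply: gh; rewrite ?sY //; apply: sh.
- by move=> y yY /=; apply: rh; rewrite ?gX ?hX ?sY //; apply: hg; apply: sY.
- apply: (IH _ T^d X) => //; first by move=> x y xX yX; apply: rh.
    by move=> x y xX yX; apply: sh.
  exact: endo_dual.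
Qed.

Lemma eq_fence n d (T : finPOrderType d) (X : {set T}) (h h' : T -> T) :
  {in X, h =1 h'} -> fence n X h -> fence n X h'.
Proof.
case: n => [|n] hh' /=.
  by case=> x0 x0X hx0; exists x0 => // x xX; rewrite -hh' ?hx0.
by case=> g [gX hg gf]; exists g; split=> // x xX; rewrite -hh' ?hg.
Qed.

Lemma fence_pad n d (T : finPOrderType d) (X : {set T}) h :
  endo X h -> fence n X h -> fence n.+1 X h.
Proof.
elim: n d T X h => [|n IH] d T X h hX; first by move=> hf; exists h; split.
move=> [g [gX hg gf]]; exists g; split=> //.
by apply: (IH _ T^d (dual_set X)) => //; apply: endo_dual.
Qed.

(** A step in the direction of the next one merges with it, and the length is
    restored by repeating the constant map. *)
Lemma fence_step n d (T : finPOrderType d) (X : {set T}) h g :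
  endo X g -> {in X, forall x, h x <= g x} ->
  fence n X g \/ fence n (dual_set X) g -> fence n.+1 X h.
Proof.
move=> gX hg [gf|gf]; last by exists g.
case: n gf => [|n] gf; first by exists g.
have [g' [g'X gg' gf']] := gf; exists g'; split=> //.
  by move=> x xX; apply: le_trans (hg x xX) (gg' x xX).
by apply: (@fence_pad _ _ T^d) => //; apply: endo_dual.
Qed.

(** [contractible_in_steps], for a starting map other than the identity. *)
Definition chain n d (T : finPOrderType d) (X : {set T}) (h : T -> T) : Prop :=
  exists (x0 : T) (f : nat -> T -> T),
    [/\ x0 \in X, forall k, (k <= n)%N -> endo X (f k),
        {in X, forall x, f 0%N x = h x}, {in X, forall x, f n x = x0} &
        forall k, (k < n)%N -> {in X, forall x, f k x <= f k.+1 x} \/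
                              {in X, forall x, f k.+1 x <= f k x}].

Lemma chain_dual n d (T : finPOrderType d) (X : {set T}) h :
  chain n (dual_set X) h -> chain n X h.
Proof.
case=> x0 [f [x0X fX f0 fn fs]]; exists x0, f; split=> //.
  by move=> k /fX; apply: (@endo_dual _ T^d).
by move=> k /fs[]; [right | left].
Qed.

Lemma chain_fence n d (T : finPOrderType d) (X : {set T}) h :
  chain n X h -> fence n X h \/ fence n (dual_set X) h.
Proof.
elim: n d T X h => [|n IH] d T X h [x0 [f [x0X fX f0 fn fs]]].
  by left; exists x0 => // x xX; rewrite -f0 ?fn.
have f1f : fence n X (f 1%N) \/ fence n (dual_set X) (f 1%N).
  apply: IH; exists x0, (fun k => f k.+1); split=> // k kn; first exact: fX.
  exact: fs.
have f1X := fX 1%N isT.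
have [f01|f10] := fs 0%N isT.
  by left; apply: (fence_step f1X) => // x xX; rewrite -f0 ?f01.
right; apply: (@fence_step _ _ T^d _ _ (f 1%N)); first exact: endo_dual.
  by move=> x xX; rewrite -f0 //; apply: f10.
by case: f1f => f1f; [right; apply/fence_dualK | left].
Qed.

Lemma fence_chain n d (T : finPOrderType d) (X : {set T}) h :
  endo X h -> fence n X h -> chain n X h.
Proof.
elim: n d T X h => [|n IH] d T X h hX.
  by case=> x0 x0X hx0; exists x0, (fun=> h); split.
case=> g [gX hg /(IH _ T^d _ _ (endo_dual gX))/(@chain_dual _ _ T)].
case=> x0 [f [x0X fX f0 fn fs]].
exists x0, (fun k => if k is k'.+1 then f k' else h); split=> //.
  by case=> // k; apply: fX.
case=> [|k]; last exact: fs.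
by left=> x xX; rewrite f0 ?hg.
Qed.

(** In an atomic poset a map below the identity fixes the minimal elements and
    hence everything, so that a fence starting downwards wastes its first
    step. *)
Lemma atomic_fence n d (T : finPOrderType d) (X : {set T}) :
  atomic X -> fence n (dual_set X) id -> fence n X id.
Proof.
case: n => // n Xat [g [[gX gh] g_le gf]].
have g_id : {in X, g =1 id}.
  move=> x xX; apply: (@le_anti _ T); apply/andP; split; first exact: (g_le x xX).
  apply: Xat => //; first exact: gX.
  move=> m mmin mx; have [mX _] := @maximalsP _ T^d X m mmin.
  have gm : g m = m.
    exact: (@maximal_fixed _ T^d X g m mmin (gX m mX) (g_le m mX)).
  by rewrite -gm; apply: gh.
apply: fence_pad; first exact: endo_id.
by apply/fence_dualK; apply: (@eq_fence _ _ T^d^d) gf => x xX; apply: g_id.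
Qed.

(** The hypothesis allows the first of the alternating steps to go up. *)
Lemma contractible_fence n d (T : finPOrderType d) (X : {set T}) :
  atomic X -> contractible_in_steps X n <-> fence n X id.
Proof.
move=> Xat; split=> [Xc|].
  by have [//|] := @chain_fence n _ _ X id Xc; apply: atomic_fence.
exact: fence_chain (endo_id X).
Qed.

(** The first step can always be taken to be the closure operator. Conversely,
    pushing a fence on [X] to the image turns its first map into the identity,
    since a monotone map above the identity fixes the maximal elements and so
    keeps a closed element below the same ones. *)
Lemma fence_inf_poset n d (T : finPOrderType d) (X : {set T}) :
  reduced_lattice X ->
  fence n.+1 X id <-> fence n (dual_set (inf_poset X)) id.
Proof.
move=> Xlat; have IX := subsetP (inf_poset_sub Xlat).
have hI := hull_in_inf_poset Xlat; have hh := hull_homo Xlat.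
split=> [[g [[gX gh] g_ge gf]]|If].
  have hg_id : {in inf_poset X, hull X \o g =1 id}.
    move=> x /(inf_posetP Xlat)[xX hx] /=.
    apply: le_anti; apply/andP; split; last first.
      exact: le_trans (g_ge x xX) (le_hull Xlat (gX x xX)).
    rewrite -[leRHS]hx; apply: hull_greatest => //.
      by apply: hull_in => //; apply: gX.
    move=> m mmax xm; apply: hull_le_maximal => //; first exact: gX.
    have [mX _] := maximalsP X m mmax.
    by rewrite -(maximal_fixed mmax (gX m mX) (g_ge m mX)); apply: gh.
  apply: (@eq_fence _ _ T^d (inf_poset X) _ _ hg_id).
  apply: (@fence_transfer n _ T^d X (inf_poset X) (hull X) id g) gf => //.
    by move=> x y xX yX; apply: hh.
  exact: (@endo_dual _ T).
exists (hull X); split; first by split=> // x xX; apply: IX; apply: hI.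
  exact: le_hull.
apply: (@fence_transfer n _ T^d (inf_poset X) X id (hull X) id) If => //.
  by move=> x y xX yX; apply: hh.
exact: (@endo_id _ T^d).
Qed.

End Fences.

(** * Iterated infima and suprema *)

Section Iterates.

Local Open Scope order_scope.

Definition bounds d (T : finPOrderType d) (lower : bool) (Y : {set T}) (b : T)
    : Prop :=
  {in Y, forall y, if lower then b <= y else y <= b}.

Definition extremals d (T : finPOrderType d) (X : {set T}) n : {set T} :=
  if odd n then maximals (iter_poset X n) else minimals (iter_poset X n).

Lemma extremals_dual d (T : finPOrderType d) (X : {set T}) n :
  extremals X n.+1 = extremals (dual_set (inf_poset X)) n.
Proof. by rewrite /extremals -iter_poset_dual /=; case: (odd n). Qed.

Lemma bounds_dual d (T : finPOrderType d) (Y : {set T}) n b :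
  bounds (odd n.+1) Y b <-> bounds (odd n) (dual_set Y) b.
Proof. by rewrite /bounds /=; case: (odd n). Qed.

Lemma extremals_sub n d (T : finPOrderType d) (X : {set T}) :
  reduced_lattice X -> {subset extremals X n <= X}.
Proof.
elim: n d T X => [|n IH] d T X Xlat e.
  exact: (subsetP (@maximals_sub _ T^d X)).
rewrite extremals_dual => eE; apply: (subsetP (inf_poset_sub Xlat)).
have Ilat := reduced_lattice_dual (reduced_lattice_inf_poset Xlat).
exact: (IH _ _ _ Ilat).
Qed.

Lemma extremals_exist n d (T : finPOrderType d) (X : {set T}) x :
  reduced_lattice X -> x \in X -> exists e, e \in extremals X n.
Proof.
elim: n d T X x => [|n IH] d T X x Xlat xX.
  by have [m mX _] := @maximal_above _ T^d X x xX; exists m.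
have Ilat := reduced_lattice_dual (reduced_lattice_inf_poset Xlat).
have [e eE] := IH _ _ _ _ Ilat (hull_in_inf_poset Xlat xX).
by exists e; rewrite extremals_dual.
Qed.

(** After [n] reductions a single step is left, that is, a greatest or a least
    element. *)
Lemma fence_iter n d (T : finPOrderType d) (X : {set T}) :
  reduced_lattice X ->
  fence n.+1 X id <->
  exists2 b, b \in iter_poset X n & bounds (odd n) (iter_poset X n) b.
Proof.
elim: n d T X => [|n IH] d T X Xlat.
  split=> [[g [_ g_ge [b bX gb]]]|[b bX Xb]].
    by exists b => // x xX; rewrite -(gb x xX) g_ge.
  by exists (fun=> b); split; [split | | exists b].
apply: iff_trans (fence_inf_poset n.+1 Xlat) _; rewrite iter_poset_dual.
have Ilat := reduced_lattice_dual (reduced_lattice_inf_poset Xlat).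
apply: iff_trans (IH _ _ _ Ilat) _.
by split=> -[b bI /bounds_dual Ib]; exists b.
Qed.

(** Being closed, the elements of [Y] stay above the closure of a lower
    bound. *)
Lemma bounds_hull lower d (T : finPOrderType d) (X Y : {set T}) b :
  reduced_lattice X -> b \in X -> {subset Y <= inf_poset X} ->
  bounds lower Y b -> bounds lower Y (hull X b).
Proof.
move=> Xlat bX YI Yb y yY; have /(inf_posetP Xlat)[yX hy] := YI y yY.
have := Yb y yY; case: lower {Yb} => y_b.
  by rewrite -hy; apply: hull_homo.
exact: le_trans y_b (le_hull Xlat bX).
Qed.

(** A bound in [X] of the extremal elements of an iterate can be closed at each
    stage, which moves it into the iterate, where by atomicity it bounds
    everything. *)
Lemma bounds_extremals n d (T : finPOrderType d) (X : {set T}) :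
  reduced_lattice X -> atomic X ->
  (exists2 b, b \in iter_poset X n & bounds (odd n) (iter_poset X n) b) <->
  (exists2 b, b \in X & bounds (odd n) (extremals X n) b).
Proof.
elim: n d T X => [|n IH] d T X Xlat Xat.
  split=> -[b bX Xb]; exists b => // x xX.
    by apply: Xb; apply: (subsetP (@maximals_sub _ T^d X)).
  by apply: Xat => // m mX _; apply: Xb.
have Ilat := reduced_lattice_dual (reduced_lattice_inf_poset Xlat).
have eI := extremals_sub (n := n) Ilat.
have IX := subsetP (inf_poset_sub Xlat).
have {}IH := IH _ _ _ Ilat (coatomic_inf_poset Xlat).
rewrite extremals_dual iter_poset_dual; split.
  move=> [b bI /bounds_dual Ib].
  have [c cI ec] := proj1 IH (ex_intro2 _ _ b bI Ib).
  by exists c; [exact: (IX c cI) | apply/bounds_dual].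
move=> [b bX eb].
have hI := hull_in_inf_poset Xlat bX.
have ehb := bounds_hull Xlat bX eI eb.
have [|c cI Ic] := proj2 IH.
  by exists (hull X b); [exact: hI | apply/bounds_dual].
by exists c; [exact: cI | apply/bounds_dual].
Qed.

Lemma contractible_extremals n d (T : finPOrderType d) (X : {set T}) :
  reduced_lattice X -> atomic X ->
  contractible_in_steps X n.+1 <->
  exists2 b, b \in X & bounds (odd n) (extremals X n) b.
Proof.
move=> Xlat Xat.
apply: iff_trans (contractible_fence n.+1 Xat) _.
exact: iff_trans (fence_iter n Xlat) (bounds_extremals n Xlat Xat).
Qed.

Lemma contractible0 d (T : finPOrderType d) (X : {set T}) :
  contractible_in_steps X 0 <-> exists x, X = [set x].
Proof.
split=> [[x0 [f [x0X _ f0 fn _]]]|[x ->]].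
  exists x0; apply/setP => x; rewrite inE; apply/idP/eqP => [xX|->//].
  by rewrite -[LHS]f0 ?fn.
exists x, (fun=> id); split=> //; first exact: set11.
  by move=> k _; split.
by move=> y /set1P.
Qed.

End Iterates.

(** * Elementary abelian subgroups *)

Section ElementaryAbelianSubgroups.

Local Open Scope group_scope.

Variables (gT : finGroupType) (G : {group gT}) (p : nat).
Hypothesis p_prime : prime p.
Implicit Types (A B : {group gT}) (S : {set {group gT}}).

Lemma ApP A :
  reflect [/\ A \subset G, p.-abelem A & A :!=: 1] (A \in Ap p G).
Proof.
rewrite inE; apply: (iffP andP) => [[/pElemP[sAG abA] A1]|[sAG abA A1]] //.
by split=> //; apply/pElemP.
Qed.

Lemma Ap_subgroup A B :
  A \in Ap p G -> B \subset A -> B :!=: 1 -> B \in Ap p G.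
Proof.
move=> /ApP[sAG abA _] sBA B1.
by apply/ApP; split; rewrite ?(abelemS sBA abA) ?(subset_trans sBA).
Qed.

Lemma cycle_in_Ap A g : A \in Ap p G -> g \in A -> g != 1 ->
  <[g]>%G \in minimals (Ap p G).
Proof.
move=> AA gA g1; have [_ abA _] := ApP A AA.
apply/(@maximalsP _ {group gT}^d); split.
  by apply: Ap_subgroup AA _ _; rewrite ?cycle_subG ?cycle_eq1.
move=> B /ApP[_ _ B1] sBg; apply/val_inj/eqP => /=; move: sBg.
have /prime_subgroupVti : prime #|<[g]>|.
  by rewrite -orderE (abelem_order_p abA).
move=> /(_ B)[sgB|tiB] sBg.
  by rewrite eqEsubset; apply/andP.
by case/negP: B1; rewrite -subG1 -tiB subsetI subxx.
Qed.

(** An elementary abelian group is the union of its subgroups of order [p]. *)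
Lemma Ap_atomic : atomic (Ap p G).
Proof.
move=> A B AA BA AB; change (A \subset B); apply/subsetP => g gA.
have [->|g1] := eqVneq g 1; first exact: group1.
have := AB _ (cycle_in_Ap AA gA g1); rewrite !subgroup_leE !cycle_subG.
by apply.
Qed.

Lemma Ap_reduced_lattice : reduced_lattice (Ap p G).
Proof.
move=> S SX /set0Pn[A AS] /set0Pn[L /lower_boundsP[/ApP[_ _ L1] LS]].
have AA := subsetP SX A AS.
exists [group of \bigcap_(B in S) B]; apply/is_infP; split.
- apply: Ap_subgroup AA _ _; first exact: bigcap_inf.
  by apply: contra L1; rewrite -!subG1; apply/subset_trans/bigcapsP.
- by move=> B BS; apply: bigcap_inf.
- by move=> B _ BS; apply/bigcapsP.
Qed.

Lemma Ap_neq0 : p %| #|G| -> Ap p G != set0.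
Proof.
move=> p_dvd; have [g gG og] := Cauchy p_prime p_dvd.
apply/set0Pn; exists <[g]>%G; apply/ApP; split; rewrite ?cycle_subG //.
  by rewrite cycle_abelem ?p_prime ?orbT ?og ?dvdnn.
by rewrite cycle_eq1 -order_gt1 og prime_gt1.
Qed.

Lemma lower_bound_ApP S : S \subset Ap p G -> S != set0 ->
  (exists2 B, B \in Ap p G & {in S, forall A, B \subset A}) <->
  \bigcap_(A in S) A != 1.
Proof.
move=> SX /set0Pn[A AS]; split=> [[B /ApP[_ _ B1] BS]|I1].
  by apply: contra B1; rewrite -!subG1; apply/subset_trans/bigcapsP.
exists [group of \bigcap_(B in S) B]; last by move=> B BS; apply: bigcap_inf.
by apply: Ap_subgroup (subsetP SX A AS) _ I1; apply: bigcap_inf.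
Qed.

(** In an abelian group generated by elements of order dividing [p] every
    element has order dividing [p], so that the generated subgroup is elementary
    abelian. *)
Lemma upper_bound_ApP S : S \subset Ap p G -> S != set0 ->
  (exists2 B, B \in Ap p G & {in S, forall A, A \subset B}) <->
  abelian <<\bigcup_(A in S) A>>.
Proof.
move=> SX /set0Pn[A AS]; split=> [[B /ApP[_ abB _] BS]|abU].
  apply: abelianS (abelem_abelian abB).
  by rewrite gen_subG; apply/bigcupsP.
exists <<\bigcup_(B in S) B>>%G; last first.
  by move=> B BS; rewrite sub_gen // (bigcup_sup B).
apply/ApP; split.
- by rewrite gen_subG; apply/bigcupsP => B /(subsetP SX)/ApP[].
- rewrite abelemE // abU /= abelian_exponent_gen; last first.
    exact: abelianS (subset_gen _) abU.
  apply/exponentP => g /bigcupP[B /(subsetP SX)/ApP[_ abB _] gB].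
  by have /(abelemP p_prime)[_ ->] := abB.
- have [_ _ A1] := ApP A (subsetP SX A AS).
  by apply: contra A1; rewrite -!subG1; apply/subset_trans/sub_gen/bigcup_sup.
Qed.

End ElementaryAbelianSubgroups.

Theorem theorem4p11 (gT : finGroupType) (G : {group gT}) (p n : nat)
    (p_prime : prime p) (p_dvd_G : p %| #|G|) :
  contractible_in_steps (Ap p G) n <->
  [\/ n = 0 /\ (exists A : {group gT}, Ap p G = [set A]),
      [/\ 1 <= n, ~~ odd n &
          (\bigcap_(A in Ap_extremals p G n.-1) A != 1)%g] |
      [/\ 1 <= n, odd n &
          abelian <<\bigcup_(A in Ap_extremals p G n.-1) A>>%g]].
Proof.
case: n => [|n].
  apply: iff_trans (contractible0 _) _; split=> [X1|]; first by constructor 1.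
  by case=> [[]|[]|[]].
have Xlat := @Ap_reduced_lattice gT G p.
have eX := introT subsetP (extremals_sub (n := n) Xlat).
have e0 : extremals (Ap p G) n != set0.
  have /set0Pn[A AX] := Ap_neq0 p_prime p_dvd_G.
  exact/set0Pn/(extremals_exist n Xlat AX).
have lowP := lower_bound_ApP eX e0.
have upP := upper_bound_ApP p_prime eX e0.
apply: iff_trans (contractible_extremals n Xlat (Ap_atomic p_prime)) _.
rewrite /bounds /=; case: (odd n).
  split=> [/lowP I1|[[]//|[_ _ I1]|[]//]]; last exact/lowP.
  by constructor 2.
split=> [/upP abU|[[]//|[]//|[_ _ abU]]]; last exact/upP.
by constructor 3.
Qed.
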